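(* Let $\mathcal G$ be a $G_\delta$ subset of $2^\omega$ with $\lambda(\mathcal G)=0$. Then the set $\{(f,\beta)\in\mathcal M\times\mathcal G\mid\beta\in D(f)\}$ is $\mathcal M$-universal for the ${\bf\Sigma}^0_3$ subsets of $\mathcal G$.
   Context: $2^{<\omega}$ is the set of finite binary sequences, $2^\omega$ the Cantor space, and $\lambda$ the Lebesgue (fair coin-tossing) product probability measure on $2^\omega$. For $\beta\in 2^\omega$, $\beta|l$ is the initial segment of $\beta$ of length $l$. A martingale is a map $f:2^{<\omega}\to[0,1]$ such that $f(s)=\frac{f(s0)+f(s1)}{2}$ for each $s\in 2^{<\omega}$. The set of martingales is denoted $\mathcal M$; it is a compact subset of $[0,1]^{2^{<\omega}}$ (product topology), with the induced topology. For $f\in\mathcal M$ and $\beta\in2^\omega$, $\mathrm{osc}(f,\beta):=\inf_{N\in\omega}\sup_{p,q\geq N}|f(\beta|p)-f(\beta|q)|$ and $D(f):=\{\beta\in2^\omega\mid \mathrm{osc}(f,\beta)>0\}$. If ${\bf\Gamma}$ is a class of subsets of Polish spaces, $X,Y$ are Polish spaces and $\mathcal U\subseteq Y\times X$, then $\mathcal U$ is $Y$-universal for the ${\bf\Gamma}$ subsets of $X$ if $\mathcal U\in{\bf\Gamma}(Y\times X)$ and ${\bf\Gamma}(X)=\{\mathcal U_y\mid y\in Y\}$, where $\mathcal U_y:=\{x\in X\mid(y,x)\in\mathcal U\}$. *)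

(* Defs.v *)
From HB Require Import structures.
From mathcomp Require Import all_boot all_order all_algebra.
From mathcomp Require Import all_classical all_reals all_analysis.

Set Implicit Arguments.
Unset Strict Implicit.
Unset Printing Implicit Defensive.

Import Order.TTheory GRing.Theory Num.Theory.
Import numFieldNormedType.Exports.

Local Open Scope classical_set_scope.
Local Open Scope ring_scope.

Definition cylinder (s : seq bool) : set cantor_space :=
  [set b | forall i, (i < size s)%N -> b i = nth false s i].

Definition determined (A : set cantor_space) (n : nat) : Prop :=
  forall b c : cantor_space,
    (forall i, (i < n)%N -> b i = c i) -> A b -> A c.

Lemma determinedW A m n : (m <= n)%N -> determined A m -> determined A n.
Proof.
by move=> mn dA b c bc; apply: dA => i im; apply/bc/(leq_trans im mn).
Qed.

Lemma determinedC A n : determined A n -> determined (~` A) n.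
Proof. by move=> dA b c bc nA /dA Ab; apply/nA/Ab => i /bc. Qed.

Lemma determinedU A B n :
  determined A n -> determined B n -> determined (A `|` B) n.
Proof.
by move=> dA dB b c bc [/(dA _ _ bc)|/(dB _ _ bc)] ?; [left|right].
Qed.

Lemma determined_cylinder s : determined (cylinder s) (size s).
Proof. by move=> b c bc bs i si; rewrite -bc// bs. Qed.

Lemma determined_open A n : determined A n -> open A.
Proof.
move=> dA; rewrite openE => b Ab.
have : \forall c \near b, forall i : 'I_n, (c : nat -> bool) i = b i.
  apply: (@filter_forall cantor_space 'I_n
    (fun i c => (c : nat -> bool) i = b i) (nbhs b)) => i.
  exact: (@proj_continuous _ (fun=> bool) (i : nat) b _ (discrete_set1 (b i))).
by apply: filterS => c bc; apply: dA Ab => i ni; rewrite (bc (Ordinal ni)).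
Qed.

Section coin_mass.
Variable R : realType.

(* proportion of the binary words of length [n] whose extension by zeros lies
   in [A] *)
Definition coin_mass (A : set cantor_space) (n : nat) : R :=
  #|[set s : n.-tuple bool | `[< A (nth false s) >]]%SET|%:R / 2 ^+ n.

Lemma coin_mass_ge0 A n : 0 <= coin_mass A n.
Proof. by rewrite divr_ge0// exprn_ge0. Qed.

Lemma coin_massS A n : determined A n -> coin_mass A n.+1 = coin_mass A n.
Proof.
move=> dA; rewrite /coin_mass.
pose f (p : n.-tuple bool * bool) := [tuple of rcons p.1 p.2].
have finj : injective f.
  by move=> [s x] [t y] /(congr1 val)/= /rcons_inj[/val_inj -> ->].
have dP (s : n.-tuple bool) x :
    A (nth false (rcons s x)) <-> A (nth false s).
  by split; apply: dA => i ni; rewrite nth_rcons size_tuple ni.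
have -> : ([set s : n.+1.-tuple bool | `[< A (nth false s) >]] =
    f @: finset.setX [set s : n.-tuple bool | `[< A (nth false s) >]]
                     [set: bool])%SET.
  apply/setP => s; rewrite inE; apply/asboolP/imsetP => [As|].
    case: s As => s; case/lastP: s => // s x ss.
    have sn : size s == n by move: ss; rewrite size_rcons.
    move=> /(dP (Tuple sn) x) As; exists (Tuple sn, x); last exact/val_inj.
    by rewrite !inE andbT; exact/asboolP.
  by move=> [[t x]]; rewrite !inE/= andbT => /asboolP At ->; exact/dP.
rewrite card_imset// cardsX cardsT card_bool natrM exprSr.
by rewrite -mulf_div divff ?mulr1// pnatr_eq0.
Qed.

Lemma coin_massE A m n : (m <= n)%N -> determined A m ->
  coin_mass A n = coin_mass A m.
Proof.
move=> /subnK <-; elim: (n - m)%N => // k IH dA.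
by rewrite addSn coin_massS ?IH//; apply: determinedW dA; rewrite leq_addl.
Qed.

Lemma coin_massU A B n : A `&` B = set0 ->
  coin_mass (A `|` B) n = coin_mass A n + coin_mass B n.
Proof.
move=> AB; rewrite /coin_mass -mulrDl -natrD; congr (_%:R / _).
rewrite -cardsUI (_ : _ :&: _ = finset.set0) ?cards0 ?addn0.
  apply: eq_card => s; rewrite !inE; apply/asboolP/orP.
    by move=> [?|?]; [left|right]; exact/asboolP.
  by move=> [/asboolP ?|/asboolP ?]; [left|right].
apply/setP => s; rewrite !inE; apply/negbTE/negP => /andP[/asboolP As /asboolP Bs].
by have : (A `&` B) (nth false s) by []; rewrite AB.
Qed.

End coin_mass.

Definition cantor_algebra : Type := cantor_space.

Definition cantor_display : measure_display. Proof. exact. Qed.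

HB.instance Definition _ := Pointed.on cantor_algebra.

Definition finitely_determined : set (set cantor_algebra) :=
  [set A | exists n, determined A n].

Lemma finitely_determined0 : finitely_determined set0.
Proof. by exists 0%N. Qed.

Lemma finitely_determinedU : setU_closed finitely_determined.
Proof.
move=> A B [m dA] [n dB]; exists (maxn m n).
by apply: determinedU; [apply: determinedW dA|apply: determinedW dB];
  rewrite leq_max leqnn ?orbT.
Qed.

Lemma finitely_determinedC : setC_closed finitely_determined.
Proof. by move=> A [n dA]; exists n; exact: determinedC. Qed.

HB.instance Definition _ := isAlgebraOfSets.Build cantor_display cantor_algebra
  finitely_determined0 finitely_determinedU finitely_determinedC.

Section coin_content.
Variable R : realType.
Local Open Scope ereal_scope.

(* independent of the chosen [n], see [coin_contentE] *)
Definition coin_content (A : set cantor_algebra) : \bar R :=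
  (coin_mass R A (xget 0%N (determined A)))%:E.

Lemma coin_contentE A n : determined A n ->
  coin_content A = (coin_mass R A n)%:E.
Proof.
move=> dA; rewrite /coin_content; case: xgetP => [m _ dA'|/(_ n)//].
by have [?|/ltnW ?] := leqP m n; [rewrite -(@coin_massE _ _ m n)|
  rewrite (@coin_massE _ _ n m)].
Qed.

Lemma coin_content_ge0 A : 0 <= coin_content A.
Proof. by rewrite lee_fin coin_mass_ge0. Qed.

Lemma coin_content_additive : measure_function.semi_additive coin_content.
Proof.
have c0 : coin_content set0 = 0.
  rewrite (@coin_contentE _ 0)// /coin_mass (_ : finset _ = finset.set0)
    ?cards0 ?mul0r//.
  by apply/setP => s; rewrite !inE; apply/negbTE/negP => /asboolP.
apply/(additive2P c0) => A B [m dA] [n dB] AB.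
have {}dA : determined A (maxn m n) by apply: determinedW dA; rewrite leq_maxl.
have {}dB : determined B (maxn m n) by apply: determinedW dB; rewrite leq_maxr.
by rewrite !(@coin_contentE _ (maxn m n)) ?coin_massU//; exact: determinedU.
Qed.

HB.instance Definition _ := isContent.Build cantor_display cantor_algebra R
  coin_content coin_content_ge0 coin_content_additive.

Lemma coin_content_sigma_additive : semi_sigma_additive coin_content.
Proof.
move=> F mF tF [n dU].
have cU : compact (\bigcup_k F k : set cantor_space).
  apply: (subclosed_compact _ cantor_space_compact) => //.
  by rewrite -openC; apply: determined_open; exact: determinedC dU.
have cU' := cU; rewrite compact_cover in cU'.
have [k _|D _ FD] := cU' nat setT (F : nat -> set cantor_space)
  _ (@subset_refl _ _).
  by have [m] := mF k; exact: determined_open.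
pose N := (\max_(k <- finmap.enum_fset D) k).+1.
have F_N b k : F k b -> (k < N)%N.
  move=> Fkb; have [|j /= jD Fjb] := FD b; first by exists k.
  have -> : k = j by apply: (tF k j) => //; exists b.
  by rewrite ltnS (bigD1_seq j)//= leq_maxl.
apply: cvg_near_cst; exists N => // p /= Np.
rewrite big_mkord -measure_semi_additive//; last first.
  by apply: bigsetU_measurable.
congr coin_content; rewrite -bigcup_mkord; apply/seteqP; split => b [k kp Fkb].
  by exists k.
by exists k => //=; exact: leq_trans (F_N _ _ Fkb) Np.
Qed.

HB.instance Definition _ := Content_isMeasure.Build cantor_display
  cantor_algebra R coin_content coin_content_sigma_additive.

End coin_content.

(* the Borel sigma-algebra of the Cantor space, see [open_cantor_borel] *)
Definition cantor_borel :=
  g_sigma_algebraType (@measurable _ cantor_algebra).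

Section coin_measure.
Variable R : realType.
Local Open Scope ereal_scope.

Definition coin_measure : set cantor_borel -> \bar R :=
  measure_extension (@coin_content R).

HB.instance Definition _ := Measure.on coin_measure.

Lemma coin_measure_cylinder (s : seq bool) :
  coin_measure (cylinder s) = (2 ^- size s)%:E.
Proof.
rewrite /coin_measure /measure_extension measurable_mu_extE/=; last first.
  by exists (size s); exact: determined_cylinder.
rewrite (coin_contentE _ (@determined_cylinder s)) /coin_mass.
rewrite (_ : finset _ = finset.set1 (in_tuple s)) ?cards1 ?mul1r//.
apply/setP => t; rewrite !inE; apply/asboolP/eqP => [ts|-> //].
apply/val_inj/(@eq_from_nth _ false) => /=; rewrite size_tuple//.
Qed.

Lemma coin_measure_setT : coin_measure setT = 1.
Proof.
rewrite (_ : setT = cylinder [::]) ?coin_measure_cylinder ?expr0 ?invr1//.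
by apply/seteqP; split.
Qed.

HB.instance Definition _ := Measure_isProbability.Build _ _ _
  coin_measure coin_measure_setT.

End coin_measure.

Lemma cylinder_mkseq (b c : cantor_space) n :
  cylinder (mkseq b n) c <-> forall i, (i < n)%N -> c i = b i.
Proof.
rewrite /cylinder/=; split=> bc i; have := bc i; rewrite ?size_mkseq => + ni.
  by rewrite nth_mkseq//; exact.
by rewrite nth_mkseq//; exact.
Qed.

Lemma cantor_nbhs_cylinder (b : cantor_space) (U : set cantor_space) :
  nbhs b U -> exists n, cylinder (mkseq b n) `<=` U.
Proof.
pose F := filter_from [set: nat] (fun n => cylinder (mkseq b n)).
have FF : Filter F.
  apply: filter_from_filter; first by exists 0%N.
  move=> m n _ _; exists (maxn m n) => // c.
  move=> /cylinder_mkseq bc.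
  by split; apply/cylinder_mkseq => i ik; apply: bc; rewrite leq_max ik ?orbT.
suff Fb : F --> b by move=> /Fb[n _ nU]; exists n.
apply/cvg_sup => i V [W] [[B] oB <-] Bbi BV; apply: (filterS BV).
exists i.+1 => // c /cylinder_mkseq/(_ i (ltnSn i)) ci.
by rewrite /= ci.
Qed.

Lemma open_cantor_borel (U : set cantor_space) :
  open U -> measurable (U : set cantor_borel).
Proof.
move=> oU.
have -> : U = \bigcup_(s in [set s | cylinder s `<=` U]) cylinder s.
  apply/seteqP; split => [b Ub|b [s sU bs]]; last exact: sU.
  have [n nU] := @cantor_nbhs_cylinder b U (open_nbhs_nbhs (conj oU Ub)).
  by exists (mkseq b n) => //; exact/cylinder_mkseq.
rewrite bigcup_mkcond; apply: countable_bigcupT_measurable.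
  exact: countableP.
move=> s; case: ifPn => // _.
by apply: sub_sigma_algebra; exists (size s); exact: determined_cylinder.
Qed.

(* [0, 1]^(2^<w) is a closed subspace of R^(2^<w), so the topology induced on
   martingales is the same from either space *)
Definition martingale (R : realType) :
    set (prod_topology (fun _ : seq bool => R)) :=
  [set f | forall s, 0 <= f s <= 1 /\
                     f s = (f (rcons s false) + f (rcons s true)) / 2].
Arguments martingale : clear implicits.

Definition initseg (b : cantor_space) (l : nat) : seq bool := mkseq b l.

(* [inf] and [sup] in [R] are only meaningful for bounded [f], such as
   martingales *)
Definition osc (R : realType) (f : seq bool -> R) (b : cantor_space) : R :=
  inf [set sup [set `|f (initseg b p) - f (initseg b q)|
                   | p in [set p | (N <= p)%N] & q in [set q | (N <= q)%N]]
          | N in [set: nat]].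

Definition divergence_set (R : realType) (f : seq bool -> R) :
    set cantor_space :=
  [set b | 0 < osc f b].

Definition pointclass : Type := forall T : topologicalType, set (set T).

(* [Sigma0 n] for finite [n >= 1]; [Sigma0 0] is empty, so that the
   premise on [m k] forces [1 <= m k < n] *)
Inductive Sigma0 (T : topologicalType) : nat -> set T -> Prop :=
| Sigma0_open A : open A -> Sigma0 1 A
| Sigma0_bigcup n (m : nat -> nat) (A : nat -> set T) :
    (forall k, (m k < n)%N) -> (forall k, Sigma0 (m k) (~` A k)) ->
    Sigma0 n (\bigcup_k A k).

Definition Sigma03 : pointclass := fun T => @Sigma0 T 3.

Definition universal_for (Gamma : pointclass) (Y X : topologicalType)
    (U : set (Y * X)) : Prop :=
  Gamma (Y * X)%type U /\
  Gamma X = [set xsection U y | y in [set: Y]].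

(* Main.v *)
(* That the set is Sigma03 is a quantifier count: [osc f b > 0] means that for
   some [k], for all [N], some [p, q >= N] have [|f (b|p) - f (b|q)| > 1/(k+1)],
   which is an open condition on [(f, b)].

   Conversely, a Sigma03 subset of [G] is a countable union of sets
   [H = G `&` \bigcap_n O n] with [O n] open.  As [G] is null, take open
   [V l] containing [G], decreasing, of measure at most [4^-(l+1)], and let
   [U n] be the set of the [b] in [W n = O n `&` U (n-1)] which lie in [V l]
   for some [l] such that the cylinder of [b|l] is included in [W n].  Then the
   density of [U n] along [b] is at most [2^-l] up to the first [l] at which
   the cylinder of [b|l] enters [W n], hence tends to [0] if [b] is not in
   [W n], while [G `&` W n] is included in [U n].  Let [f] be the martingale of
   densities of [(U 0 \ U 1) + (U 2 \ U 3) + ...].  On [H] it is infinitely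
   often at least [3/4] and infinitely often at most [1/4].  If [b] is in [G]
   and [n] is the least index with [b] not in [O n], then [b] is interior to
   [U j] for [j < n] and [U n] has density [0] at [b], so [f] converges along
   [b].  Outside of [G] nothing is claimed, which is what
   makes so simple a choice possible.

   The martingales of the sets [H_0, H_1, ...] are added with weights decreasing
   so fast that the first divergent one cannot be compensated by the later
   ones. *)
Require Import Defs.
From mathcomp Require Import all_boot all_order all_algebra.
From mathcomp Require Import all_classical all_reals all_analysis.
From mathcomp Require Import borel_hierarchy.
From mathcomp Require Import zify ring lra.
Import Order.TTheory GRing.Theory Num.Theory.
Import numFieldNormedType.Exports.
Local Open Scope classical_set_scope.
Local Open Scope ring_scope.

(** * Oscillation along a branch as a Sigma03 condition *)

Definition oscillates {R : realType} (u : nat -> R) : Prop :=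
  exists2 e : R, 0 < e &
    forall N, exists p q, [/\ (N <= p)%N, (N <= q)%N & e < `|u p - u q|].

(** Boundedness of [f] gives every tail set of differences a genuine supremum, so positive
    oscillation means one threshold exceeded in every tail; halving the oscillation makes the
    inequality strict. *)
Lemma osc_gt0P (R : realType) (f : seq bool -> R) (b : cantor_space) :
  (forall s, 0 <= f s <= 1) ->
  0 < osc f b <-> oscillates (fun l => f (initseg b l)).
Proof.
move=> f01.
pose S N : set R := [set `|f (initseg b p) - f (initseg b q)|
  | p in [set p | (N <= p)%N] & q in [set q | (N <= q)%N]].
have S0 N : S N !=set0.
  by exists `|f (initseg b N) - f (initseg b N)|; exists N => /=;
    [exact: leqnn|exists N => /=; [exact: leqnn|]].
have ubS N : has_sup (S N).
  split => //; exists 1 => _ [p _ [q _ <-]].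
  rewrite ler_norml; have := f01 (initseg b p); have := f01 (initseg b q).
  lra.
have Sge N x : S N x -> x <= sup (S N).
  exact: (ub_le_sup (ubS N).2).
split => [osc0|[e e0 He]].
  exists (osc f b / 2); first lra.
  move=> N; have oS : osc f b <= sup (S N).
    apply: ge_inf; last by exists N.
    exists 0 => _ [M _ <-].
    apply: le_trans (Sge M _ _); last first.
      by exists M => /=; [exact: leqnn|exists M => /=; [exact: leqnn|]].
    exact: normr_ge0.
  have [|_ [p Np [q Nq <-]] epq] := sup_gt (x := osc f b / 2) (S0 N).
    lra.
  by exists p, q.
apply: (lt_le_trans e0); apply: lb_le_inf; first by exists (sup (S 0%N)), 0%N.
move=> _ [N _ <-]; have [p [q [Np Nq epq]]] := He N.
by apply: le_trans (ltW epq) (Sge _ _ _); exists p => //; exists q.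
Qed.

(** The thresholds [k.+1%:R^-1] suffice, which makes the outer union countable. The space is
    arbitrary because the lemma serves both the product and its sections. *)
Lemma Sigma0_oscillates (R : realType) (X : topologicalType)
    (E : nat -> X -> R) : (forall l, continuous (E l)) ->
  Sigma0 3 [set x | oscillates (E ^~ x)].
Proof.
move=> cE.
pose O (k N : nat) : set X := \bigcup_p \bigcup_q
  [set x | [/\ (N <= p)%N, (N <= q)%N & k.+1%:R^-1 < `|E p x - E q x|]].
have oO k N : open (O k N).
  apply: bigcup_open => p _; apply: bigcup_open => q _.
  have [Np|Np] := boolP (N <= p)%N; last first.
    rewrite (_ : [set x | _] = set0); first exact: open0.
    by apply/seteqP; split => x // [].
  have [Nq|Nq] := boolP (N <= q)%N; last first.
    rewrite (_ : [set x | _] = set0); first exact: open0.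
    by apply/seteqP; split => x // [].
  rewrite (_ : [set x | _] =
    (fun x => `|E p x - E q x|) @^-1` [set y | k.+1%:R^-1 < y]); last first.
    by apply/seteqP; split => x // [].
  apply: open_comp; last exact: open_gt.
  by move=> x _; apply: cvg_norm; apply: cvgB; exact: cE.
rewrite (_ : [set x | _] = \bigcup_k \bigcap_N O k N); last first.
  apply/seteqP; split => x /=.
    move=> [e e0 He].
    have [k ke] : exists k, k.+1%:R^-1 < e.
      have := archi_boundP (ltW (_ : 0 < e^-1)); rewrite invr_gt0 => /(_ e0).
      move=> eb; exists (Num.bound e^-1); rewrite invf_plt ?posrE//.
      by apply: lt_trans eb _; rewrite ltr_nat.
    exists k => // N _; have [p [q [Np Nq epq]]] := He N.
    by exists p => //; exists q => //; split => //; exact: lt_trans epq.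
  move=> [k _ Hk]; exists k.+1%:R^-1; first by rewrite invr_gt0.
  by move=> N; have [p _ [q _ []]] := Hk N I; exists p, q.
apply: (@Sigma0_bigcup _ _ (fun=> 2%N)) => // k.
rewrite setC_bigcap; apply: (@Sigma0_bigcup _ _ (fun=> 1%N)) => // N.
by rewrite setCK; exact: Sigma0_open.
Qed.

Lemma initseg_near (b : cantor_space) l :
  \forall c \near b, initseg c l = initseg b l.
Proof.
have : \forall c \near b, cylinder (mkseq b l) c.
  apply: open_nbhs_nbhs; split; last exact/cylinder_mkseq.
  exact: determined_open (@determined_cylinder _).
apply: filterS => c /cylinder_mkseq bc.
by apply/eq_in_map => i; rewrite mem_iota/= => /bc.
Qed.

Lemma continuous_set_val {T : topologicalType} (A : set T) :
  continuous (set_val : A -> T).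
Proof. exact: initial_continuous. Qed.

(** Near a point the word [initseg c l] is constant, so the map agrees locally with the evaluation
    at a fixed word, a projection. *)
Lemma continuous_value (R : realType) (G : set cantor_space) l :
  continuous (fun p : (martingale R * G)%type =>
    set_val p.1 (initseg (set_val p.2) l) : R).
Proof.
move=> [f b] /=.
have cs s : {for (f, b), continuous (fun p : (martingale R * G)%type =>
    set_val p.1 s : R)}.
  apply: (@continuous_comp _ _ _
    (fun p : (martingale R * G)%type => set_val p.1)
    (fun g : prod_topology (fun _ : seq bool => R) => g s)); last first.
    exact: proj_continuous.
  apply: (@continuous_comp _ _ _ fst set_val); first exact: cvg_fst.
  exact: continuous_set_val.
have := cs (initseg (set_val b) l).
apply: cvg_trans; apply: near_eq_cvg.
have : \forall c \near b, initseg (set_val c) l = initseg (set_val b) l.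
  exact: (@continuous_set_val _ G b) _ (initseg_near _ _).
move=> bl; exists (setT,
    [set c | initseg (set_val c) l = initseg (set_val b) l]).
  by split => //; exact: filterT.
by move=> [g c] [_ /= ->].
Qed.

(** * Gdelta and Sigma03 subsets of a subspace *)

Lemma closed_cantor_Gdelta (F : set cantor_space) : closed F -> Gdelta F.
Proof.
(* The union of the cylinders of length [n] that meet [F]: a point in all these unions is a limit of
   points of [F]. *)
move=> cF; exists (fun n => \bigcup_(c in F) cylinder (mkseq c n)).
  move=> n; apply: bigcup_open => c _.
  exact: determined_open (@determined_cylinder _).
apply/seteqP; split => [b Fb n _|b Hb].
  by exists b => //; exact/(cylinder_mkseq b b n).
apply: contrapT => nFb.
have [|n nF] := @cantor_nbhs_cylinder b (~` F).
  by apply: open_nbhs_nbhs; split => //; rewrite openC.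
have [c Fc /cylinder_mkseq cb] := Hb n I.
by apply: (nF c) Fc; apply/cylinder_mkseq => i /cb.
Qed.

Lemma open_subtypeP {T : topologicalType} {G : set T} {A : set G} :
  open A -> exists2 O : set T, open O & A = set_val @^-1` O.
Proof. by move=> [U oU <-]; exists U. Qed.

Lemma Sigma0_gt0 {T : topologicalType} {n} {A : set T} :
  Sigma0 n A -> (0 < n)%N.
Proof. by case=> // {}n m B mn _; exact: leq_ltn_trans (mn 0%N). Qed.

(** The union constructor cannot reach level 1, as its premises would have level 0, which is
    empty. *)
Lemma Sigma0_1_open {T : topologicalType} {A : set T} : Sigma0 1 A -> open A.
Proof.
move e : 1%N => n SA; case: SA e => // {}n m B mn SB n1; exfalso.
have := Sigma0_gt0 (SB 0%N); have := mn 0%N.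
by rewrite -n1 ltnS leqNgt => /negP.
Qed.

(** A complement of level 1 makes [A] closed in [G], hence the trace of a Gdelta set; at level 2 the
    complements of the [B k] are open and lift one by one. Both levels occur, since the [m k] in a
    union may vary with [k]. *)
Lemma Sigma0_lt3_setC {G : set cantor_space} {n} {A : set G} :
  (n < 3)%N -> Sigma0 n (~` A) ->
  exists2 O : nat -> set cantor_space, (forall k, open (O k)) &
    A = set_val @^-1` \bigcap_k O k.
Proof.
move=> n3 SA; rewrite -[A]setCK; move: (~` A) SA => {}A SA.
case: SA n3 => [B /open_subtypeP[U oU ->] _|{}n m B mn SB n3].
  have [|F oF OF] := @closed_cantor_Gdelta (~` U); first by rewrite closedC.
  by exists F => //; rewrite -OF.
have openB k : open (~` B k).
  apply: Sigma0_1_open; suff <- : m k = 1%N by [].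
  apply/eqP; rewrite eqn_leq (Sigma0_gt0 (SB k)) andbT -ltnS.
  exact: leq_trans (mn k) _.
have /choice[U HU] k : exists O, open O /\ ~` B k = set_val @^-1` O.
  by have [U oU BU] := open_subtypeP (openB k); exists U.
exists U => [k|]; first by have [] := HU k.
rewrite setC_bigcup preimage_bigcap; apply: eq_bigcapr => k _.
by have [] := HU k.
Qed.

(** The [O n k] are open in the whole Cantor space, where the densities below are measured. *)
Lemma Sigma03_subtype {G : set cantor_space} {A : set G} :
  Sigma0 3 A ->
  exists2 O : nat -> nat -> set cantor_space, (forall n k, open (O n k)) &
    A = set_val @^-1` \bigcup_n \bigcap_k O n k.
Proof.
move e : 3%N => n SA; case: SA e => // {}n m B mn SB n3; subst n.
have /choice[U HU] k : exists O : nat -> set cantor_space,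
    (forall j, open (O j)) /\
    B k = set_val @^-1` \bigcap_j O j.
  by have [U oU BU] := Sigma0_lt3_setC (mn k) (SB k); exists U.
exists U => [n k|]; first by have [] := HU n.
by rewrite preimage_bigcup; apply: eq_bigcupr => k _; have [] := HU k.
Qed.

(** * Densities on cylinders and open covers of null sets *)

Lemma cylinder_open (s : seq bool) : open (cylinder s).
Proof. exact: determined_open (@determined_cylinder s). Qed.

Lemma cylinder_borel (s : seq bool) :
  measurable (cylinder s : set cantor_borel).
Proof. exact: open_cantor_borel (cylinder_open s). Qed.

Lemma sub_cylinder_mkseq (b : nat -> bool) {m n} : (m <= n)%N ->
  cylinder (mkseq b n) `<=` cylinder (mkseq b m).
Proof.
move=> mn c /(cylinder_mkseq b c n) bc; apply/(cylinder_mkseq b c m) => i im.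
exact/bc/(leq_trans im).
Qed.

Lemma cylinder_rcons (s : seq bool) :
  cylinder s = cylinder (rcons s false) `|` cylinder (rcons s true).
Proof.
have sub x : cylinder (rcons s x) `<=` cylinder s.
  move=> b bs i si; rewrite bs ?size_rcons ?nth_rcons ?si//.
  exact: ltn_trans si _.
apply/seteqP; split => [b bs|]; last by rewrite subUset.
suff : cylinder (rcons s (b (size s))) b.
  by case: (b (size s)); [right|left].
move=> i; rewrite size_rcons ltnS leq_eqVlt nth_rcons => /orP[/eqP ->|si].
  by rewrite ltnn eqxx.
by rewrite si bs.
Qed.

Lemma cylinder_rcons_disjoint (s : seq bool) :
  cylinder (rcons s false) `&` cylinder (rcons s true) = set0.
Proof.
apply/seteqP; split => // b [/(_ (size s)) + /(_ (size s))].
by rewrite !size_rcons !nth_rcons !ltnn !eqxx => -> // /(_ (ltnSn _)).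
Qed.

Lemma half_expr_lt {R : realType} {e : R} : 0 < e -> exists n, 2^-1 ^+ n < e.
Proof.
move=> e0; exists (Num.bound e^-1).
rewrite exprVn invf_plt ?posrE ?exprn_gt0//.
apply: lt_trans (archi_boundP _) _; first by rewrite invr_ge0 ltW.
by rewrite -natrX ltr_nat ltn_expl.
Qed.

Section coin_density.
Context {R : realType}.
Local Notation mu := (@coin_measure R).

(** The conditional probability of [E] given the cylinder of [s], whose measure is [2 ^- size s]. *)
Definition coin_density (E : set cantor_borel) (s : seq bool) : R :=
  fine (mu (E `&` cylinder s)) * 2 ^+ size s.

Lemma coin_measure_fin_num (E : set cantor_borel) :
  measurable E -> mu E \is a fin_num.
Proof. by move=> mE; exact: fin_num_measure. Qed.

Lemma coin_density_le (E F : set cantor_borel) s :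
  measurable E -> measurable F -> E `&` cylinder s `<=` F `&` cylinder s ->
  coin_density E s <= coin_density F s.
Proof.
move=> mE mF EF; apply: ler_wpM2r; first exact: exprn_ge0.
have ? := cylinder_borel s.
apply: fine_le; rewrite ?coin_measure_fin_num//; try exact: measurableI.
by apply: le_measure => //; rewrite inE; exact: measurableI.
Qed.

Lemma coin_densityT s : coin_density setT s = 1.
Proof.
rewrite /coin_density setTI coin_measure_cylinder/=.
by rewrite mulVf// expf_neq0.
Qed.

Lemma coin_densityU (E F : set cantor_borel) s :
  measurable E -> measurable F -> E `&` F = set0 ->
  coin_density (E `|` F) s = coin_density E s + coin_density F s.
Proof.
move=> mE mF EF; have ? := cylinder_borel s.
rewrite /coin_density setIUl measureU; first last.
- by rewrite setIACA EF set0I.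
- exact: measurableI.
- exact: measurableI.
by rewrite fineD ?mulrDl// coin_measure_fin_num//; exact: measurableI.
Qed.

Lemma coin_density01 (E : set cantor_borel) s :
  measurable E -> 0 <= coin_density E s <= 1.
Proof.
move=> mE; rewrite mulr_ge0 ?exprn_ge0 ?fine_ge0//=.
by rewrite -(coin_densityT s) coin_density_le// => b [_ ?]; split.
Qed.

Lemma martingale_coin_density (E : set cantor_borel) :
  measurable E -> martingale R (coin_density E).
Proof.
move=> mE s; split; first exact: coin_density01.
rewrite /coin_density {1}cylinder_rcons setIUr.
have mc t : measurable (E `&` cylinder t).
  by apply: measurableI => //; exact: cylinder_borel.
rewrite measureU//; last by rewrite setIACA cylinder_rcons_disjoint setI0.
by rewrite fineD ?coin_measure_fin_num// !size_rcons exprS; field.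
Qed.

Lemma coin_density_le_measure (E F : set cantor_borel) s (e : R) :
  measurable E -> measurable F -> E `&` cylinder s `<=` F -> (mu F <= e%:E)%E ->
  coin_density E s <= e * 2 ^+ size s.
Proof.
move=> mE mF EF Fe; apply: ler_wpM2r; first exact: exprn_ge0.
have mI : measurable (E `&` cylinder s).
  by apply: measurableI => //; exact: cylinder_borel.
rewrite -lee_fin fineK ?coin_measure_fin_num//; apply: le_trans Fe.
by apply: le_measure => //; rewrite inE.
Qed.

(** The value of [coin_measure] on any set is the infimum of the total contents of its countable
    covers by finitely determined sets, which are open. *)
Lemma null_open_cover (G : set cantor_space) (e : R) :
  mu G = 0%E -> 0 < e ->
  exists V : set cantor_space, [/\ open V, G `<=` V & (mu V <= e%:E)%E].
Proof.
move=> G0 e0; have : (mu G < e%:E)%E by rewrite G0 lte_fin.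
rewrite {1}/coin_measure /measure_extension /mu_ext.
move=> /ereal_inf_lt[_ [F [mF GF] <-] Fe].
exists (\bigcup_k F k); split => //.
  by apply: bigcup_open => k _; have [n] := mF k; exact: determined_open.
apply: le_trans (ltW Fe).
have mF' k : measurable (F k : set cantor_borel).
  by apply: sub_sigma_algebra; exact: mF.
have := @measure_sigma_subadditive _ _ _ mu _ _ mF'
  (bigcupT_measurable _ mF') (fun _ h => h).
move=> /le_trans; apply.
apply: lee_nneseries => // k _.
by rewrite -[X in (_ <= X)%E]measurable_mu_extE.
Qed.

(** Multiplied by [2 ^+ l], the bound becomes [4^-1 * 2^-1 ^+ l]: at most 1/4 for every [l], and
    tending to 0. Finite intersections make the sequence decreasing. *)
Lemma null_open_covers (G : set cantor_space) : mu G = 0%E ->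
  exists V : nat -> set cantor_space,
    [/\ forall l, open (V l), forall l, G `<=` V l,
        forall l m, (l <= m)%N -> V m `<=` V l &
        forall l, (mu (V l) <= (4^-1 ^+ l.+1)%:E)%E].
Proof.
move=> G0.
have /choice[V VP] l : exists V : set cantor_space,
    [/\ open V, G `<=` V & (mu V <= (4^-1 ^+ l.+1)%:E)%E].
  by apply: null_open_cover => //; rewrite exprn_gt0// invr_gt0.
have oV l : open (\big[setI/setT]_(i < l.+1) V i).
  elim/big_ind : _ => [|A B|i _]; [exact: openT|exact: openI|].
  by have [] := VP i.
exists (fun l => \big[setI/setT]_(i < l.+1) V i); split=> //.
- move=> l b Gb; rewrite -bigcap_mkord => i _; have [_ + _] := VP i; exact.
- move=> l m lm; rewrite -!bigcap_mkord => b Vb i il; apply: Vb.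
  exact: leq_trans il _.
- move=> l; have [oVl _ +] := VP l; apply: le_trans.
  apply: le_measure; rewrite ?inE; try exact: open_cantor_borel.
  by rewrite big_ord_recr/= => b [].
Qed.

(** * Nested open sets and the densities of their alternating differences *)

Definition refine (V : nat -> set cantor_space) (W : set cantor_space) :
    set cantor_space :=
  [set b | exists2 l, cylinder (mkseq b l) `<=` W & V l b].

Lemma sub_refine V W : refine V W `<=` W.
Proof. by move=> b [l + _]; apply; exact/(cylinder_mkseq b b l). Qed.

Lemma refine_open V W : (forall l, open (V l)) -> open (refine V W).
Proof.
move=> oV; rewrite (_ : refine V W =
  \bigcup_l ([set b : cantor_space | cylinder (mkseq b l) `<=` W] `&` V l)).
  apply: bigcup_open => l _; apply: openI => //; apply: (@determined_open _ l).
  move=> b c bc /=; suff -> : mkseq b l = mkseq c l by [].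
  by apply/eq_in_map => i; rewrite mem_iota/= => /bc.
apply/seteqP; split => b.
  by move=> [l ? ?]; exists l.
by move=> [l _ [? ?]]; exists l.
Qed.

Lemma refine_in {V W} {b : cantor_space} :
  open W -> (forall l, V l b) -> W b -> refine V W b.
Proof.
move=> oW Vb Wb.
have [l lW] := @cantor_nbhs_cylinder b W (open_nbhs_nbhs (conj oW Wb)).
by exists l.
Qed.

(** A point [c] of the left side enters at some [k] with the cylinder of [c|k] inside [W]. If
    [k < l] then [c|k = b|k], against the hypothesis; so [k >= l] and [V k] is included in [V l]. *)
Lemma refine_cylinder {V W} {b : cantor_space} {l} :
  (forall l m, (l <= m)%N -> V m `<=` V l) ->
  (forall k, (k < l)%N -> ~ cylinder (mkseq b k) `<=` W) ->
  refine V W `&` cylinder (mkseq b l) `<=` V l.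
Proof.
move=> decV bW c [[k kW Vc] /(cylinder_mkseq b c l) bc].
apply: decV Vc; rewrite leqNgt; apply/negP => kl.
apply: (bW k kl); suff -> : mkseq b k = mkseq c k by [].
apply/eq_in_map => i; rewrite mem_iota/= => ik.
by rewrite bc// (ltn_trans ik).
Qed.

Fixpoint nested (V O : nat -> set cantor_space) (n : nat) : set cantor_space :=
  refine V (O n `&` if n is n'.+1 then nested V O n' else setT).

Lemma nested_dec V O m n : (m <= n)%N -> nested V O n `<=` nested V O m.
Proof.
move=> /subnK <-; elim: (n - m)%N => // k IH b /sub_refine[_].
exact: IH.
Qed.

(** For decreasing [U], a point belongs to this set exactly when there is a least [n] with the point
    outside [U n], and this [n] is odd. *)
Definition alternate (U : nat -> set cantor_space) : set cantor_space :=
  \bigcup_n (U n.*2 `\` U n.*2.+1).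

Lemma alternate_even {U n} {b : cantor_space} :
  (forall m n, (m <= n)%N -> U n `<=` U m) -> ~~ odd n ->
  (forall j, (j < n)%N -> U j b) -> alternate U b -> U n b.
Proof.
move=> decU n2 Ub [k _ [Uk nUk]].
have [kn|nk] := ltnP k.*2.+1 n; first by case: nUk; exact: Ub.
by apply: decU Uk; lia.
Qed.

Lemma alternate_odd {U n} {b : cantor_space} :
  odd n -> (forall j, (j < n)%N -> U j b) -> ~ U n b -> alternate U b.
Proof.
case: n => // n /= n2 Ub nUb; exists n./2 => //.
by rewrite even_halfK//; split => //; exact: Ub.
Qed.

(** On a cylinder inside all [U j] with [j < n], the alternating set is included in [U n] if [n] is
    even and contains the complement of [U n] if [n] is odd. *)
Lemma coin_density_alternate (U : nat -> set cantor_space) n s :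
  (forall n, open (U n)) -> (forall m n, (m <= n)%N -> U n `<=` U m) ->
  (forall j, (j < n)%N -> cylinder s `<=` U j) ->
  `|coin_density (alternate U) s - (odd n)%:R| <= coin_density (U n) s.
Proof.
move=> oU decU sU.
have mU k : measurable (U k : set cantor_borel) by exact: open_cantor_borel.
have mA : measurable (alternate U : set cantor_borel).
  by apply: bigcupT_measurable => k; exact: measurableD.
have [A0 A1] := andP (coin_density01 _ s mA).
have [n1|n0] := boolP (odd n); last first.
  rewrite subr0 ger0_norm//.
  apply: coin_density_le => // b [Ab sb]; split => //.
  by apply: alternate_even Ab => // j jn; exact: sU.
rewrite distrC ger0_norm ?subr_ge0//.
rewrite lerBlDr -(coin_densityT s) addrC -{1}(setvU (U n)) setUC.
rewrite coin_densityU ?setICr//; last exact: measurableC.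
rewrite [leRHS]addrC lerD2l.
apply: coin_density_le => //; first exact: measurableC.
move=> b [nUb sb]; split => //.
by apply: alternate_odd n1 _ nUb => j jn; exact: sU.
Qed.

(** The gap 1/2 is independent of [O] and [b], so it can later be weighed against fixed geometric
    weights. *)
Lemma martingale_null_Gdelta (G : set cantor_space)
    (O : nat -> set cantor_space) :
  mu G = 0%E -> (forall n, open (O n)) ->
  exists f : seq bool -> R, [/\ martingale R f,
    forall b, G b -> (forall n, O n b) -> forall N, exists p q,
      [/\ (N <= p)%N, (N <= q)%N &
        2^-1 <= f (initseg b p) - f (initseg b q)] &
    forall b, G b -> ~ (forall n, O n b) -> 
      cvgn (fun p => f (initseg b p))].
Proof.
move=> /null_open_covers[V [oV GV decV muV]] oO.
pose U := nested V O.
pose W n := O n `&` if n is n'.+1 then U n' else setT.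
have UE n : U n = refine V (W n) by case: n.
have oU n : open (U n) by rewrite UE; exact: refine_open.
have decU m n : (m <= n)%N -> U n `<=` U m by exact: nested_dec.
have oW n : open (W n) by apply: openI => //; case: n => [|n]; [exact: openT|].
have WU n j : (j < n)%N -> W n `<=` U j.
  by case: n => // n jn b [_]; apply: decU.
have GU n b : G b -> (forall j, (j <= n)%N -> O j b) -> U n b.
  move=> Gb; elim: n => [|n IH] Ob; rewrite UE.
    by apply: refine_in => //; [move=> l; exact: GV|split => //; exact: Ob].
  apply: refine_in => //; first by move=> l; exact: GV.
  by split; [exact: Ob|apply: IH => j jn; apply: Ob; exact: leqW].
have mU k : measurable (U k : set cantor_borel) by exact: open_cantor_borel.
have mA : measurable (alternate U : set cantor_borel).
  by apply: bigcupT_measurable => k; exact: measurableD.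
have dU b l n : (forall k, (k < l)%N -> ~ cylinder (mkseq b k) `<=` W n) ->
    coin_density (U n) (mkseq b l) <= 4^-1 * 2^-1 ^+ l.
  move=> bW; have : coin_density (U n) (mkseq b l) <=
      4^-1 ^+ l.+1 * 2 ^+ size (mkseq b l).
    apply: (@coin_density_le_measure _ (V l)) => //.
      exact: open_cantor_borel.
    by rewrite UE; exact: refine_cylinder.
  rewrite size_mkseq exprS -mulrA -exprMn.
  by rewrite (_ : 4^-1 * 2 = 2^-1 :> R)//; field.
exists (coin_density (alternate U)); split.
- exact: martingale_coin_density.
- move=> b Gb Ob.
  have bU n : U n b by exact: GU.
  have exl n : exists l, `[< cylinder (mkseq b l) `<=` W n >].
    have Wb : W n b by split => //; case: n => [|n].
    have [l lW] := @cantor_nbhs_cylinder b (W n)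
      (open_nbhs_nbhs (conj (oW n) Wb)).
    by exists l; exact/asboolP.
  (* At length [L n], the first at which the cylinder of [b] is inside [W n], all earlier [U j] fill
     the cylinder and [U n] has density at most 1/4 in it; so the density of [alternate U] is within
     1/4 of the parity of [n]. *)
  pose L n := ex_minn (exl n).
  have LW n : cylinder (mkseq b (L n)) `<=` W n.
    by rewrite /L; case: ex_minnP => l /asboolP.
  have Lmin n k : (k < L n)%N -> ~ cylinder (mkseq b k) `<=` W n.
    rewrite /L; case: ex_minnP => l _ lmin kl /asboolP/lmin.
    by rewrite leqNgt kl.
  have dL n : coin_density (U n) (mkseq b (L n)) <= 4^-1.
    apply: le_trans (dU _ _ _ (Lmin n)) _.
    by rewrite ler_piMr// exprn_ile1//; lra.
  (* [U n] has density at most 1/4 at length [L n], but density 1 from length [L n.+1] on, where the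
     cylinder is inside [W n.+1] and so inside [U n]. *)
  have Lmono n : (L n < L n.+1)%N.
    rewrite ltnNge; apply/negP => LL; have := dL n.
    suff : 1 <= coin_density (U n) (mkseq b (L n)) by lra.
    rewrite -(coin_densityT (mkseq b (L n))); apply: coin_density_le => //.
    move=> c [_ cb]; split => //; apply: (WU n.+1) => //; apply: LW.
    exact: sub_cylinder_mkseq LL _ cb.
  have Lge n : (n <= L n)%N.
    by elim: n => // n IH; exact: leq_ltn_trans (Lmono n).
  have fL n :
      `|coin_density (alternate U) (initseg b (L n)) - (odd n)%:R| <= 4^-1.
    apply: le_trans (dL n); apply: coin_density_alternate => // j jn c /LW.
    exact: WU.
  (* The odd index gives a density of at least 3/4, the even one at most 1/4. *)
  move=> N; exists (L N.*2.+1), (L N.*2); split.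
  + by apply: leq_trans (Lge _); lia.
  + by apply: leq_trans (Lge _); lia.
  + have := fL N.*2.+1; have := fL N.*2.
    rewrite /= odd_double/= !ler_norml; lra.
- move=> b Gb /existsNP nOb.
  have exn : exists n, `[< ~ O n b >].
    by case: nOb => n ?; exists n; exact/asboolP.
  case: (ex_minnP exn) => n /asboolP nOnb nmin.
  have Ub j : (j < n)%N -> U j b.
    move=> jn; apply: GU => // i ij; apply: contrapT => nOi.
    by have := nmin i (asboolT nOi); lia.
  have [N1 HN1] : exists N, forall j, (j < n)%N ->
      cylinder (mkseq b N) `<=` U j.
    case: n {nOnb nmin} Ub => [|n] Ub; first by exists 0%N.
    have [N HN] := @cantor_nbhs_cylinder b (U n)
      (open_nbhs_nbhs (conj (oU n) (Ub n (ltnSn n)))).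
    by exists N => j jn c /HN; apply: decU.
  (* The limit is the parity of [n]. Since [b] is not in [O n], none of its cylinders is inside
     [W n], so the bound [dU] holds at every length; from [N1] on the earlier [U j] fill the
     cylinder. *)
  apply/cvg_ex; exists (odd n)%:R; apply/cvgrPdist_le => e e0.
  have [N2 HN2] := half_expr_lt e0.
  exists (maxn N1 N2) => // p /=; rewrite geq_max => /andP[N1p N2p].
  rewrite distrC.
  apply: le_trans (ltW HN2).
  apply: le_trans (_ : 2^-1 ^+ p <= _); last by apply: ler_wiXn2l => //; lra.
  apply: le_trans (_ : 4^-1 * 2^-1 ^+ p <= _); last first.
    by rewrite ler_piMl ?exprn_ge0//; lra.
  apply: le_trans (dU b p n _); last first.
    move=> k _ kW; apply: nOnb; have [] // : W n b.
    by apply: kW; exact/(cylinder_mkseq b b k).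
  apply: coin_density_alternate => // j jn c cb; apply: (HN1 j jn).
  exact: sub_cylinder_mkseq N1p _ cb.
Qed.

End coin_density.

(** * Sums with geometric weights *)

Lemma quarter_expr_lt {R : realType} {e : R} : 0 < e -> exists n, 4^-1 ^+ n < e.
Proof.
move=> /half_expr_lt[n ne]; exists n; apply: le_lt_trans ne.
by apply: lerXn2r; rewrite ?nnegrE; lra.
Qed.

(* The weights [3/4 * 4^-k] sum to [1], and each of them exceeds twice the sum
   of the later ones. *)
Definition weighted_sum {R : realType} {T : Type} (F : nat -> T -> R) (n : nat)
    (t : T) : R :=
  \sum_(k < n) 3 / 4 * 4^-1 ^+ k * F k t.

Lemma weighted_sumS {R : realType} {T : Type} (F : nat -> T -> R) n t :
  weighted_sum F n.+1 t = weighted_sum F n t + 3 / 4 * 4^-1 ^+ n * F n t.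
Proof. by rewrite /weighted_sum big_ord_recr. Qed.

(** The [n]-th weight is [4^-1 ^+ n - 4^-1 ^+ n.+1], so the lower bounds increase with [n] and the
    upper bounds decrease; the supremum of the lower bounds lies between them. *)
Lemma weighted_sum_lim {R : realType} {T : Type} (F : nat -> T -> R) :
  (forall k t, 0 <= F k t <= 1) ->
  exists f : T -> R, forall n t,
    weighted_sum F n t <= f t <= weighted_sum F n t + 4^-1 ^+ n.
Proof.
move=> F01.
have PS n t : weighted_sum F n t <= weighted_sum F n.+1 t /\
    weighted_sum F n.+1 t + 4^-1 ^+ n.+1 <= weighted_sum F n t + 4^-1 ^+ n.
  rewrite weighted_sumS exprS; have := F01 n t.
  have : (0 : R) <= 4^-1 ^+ n by rewrite exprn_ge0.
  by move: (4^-1 ^+ n) => x x0 /andP[F0 F1]; split; nra.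
have P_le m n t : (m <= n)%N -> weighted_sum F m t <= weighted_sum F n t.
  move=> /subnK <-; elim: (n - m)%N => // k IH.
  by apply: le_trans IH _; exact: (PS _ t).1.
have Q_le m n t : (m <= n)%N ->
    weighted_sum F n t + 4^-1 ^+ n <= weighted_sum F m t + 4^-1 ^+ m.
  move=> /subnK <-; elim: (n - m)%N => // k IH.
  by apply: le_trans IH; exact: (PS _ t).2.
have PQ m n t : weighted_sum F m t <= weighted_sum F n t + 4^-1 ^+ n.
  have [mn|/ltnW nm] := leqP m n.
    by apply: le_trans (P_le _ _ _ mn) _; rewrite lerDl exprn_ge0.
  by apply: le_trans (Q_le _ _ _ nm); rewrite lerDl exprn_ge0.
exists (fun t => sup (range (weighted_sum F ^~ t))) => n t; apply/andP; split.
  apply: ub_le_sup; last by exists n.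
  by exists (weighted_sum F 0 t + 4^-1 ^+ 0) => _ [m _ <-].
apply: ge_sup; first by exists (weighted_sum F 0 t), 0%N.
by move=> _ [m _ <-].
Qed.

(** The averaging identity is exact for partial sums, so its defect for [f] is at most [4^-1 ^+ n]
    for every [n]. *)
Lemma martingale_weighted_sum_lim {R : realType} (F : nat -> seq bool -> R)
    (f : seq bool -> R) :
  (forall k, martingale R (F k)) ->
  (forall n s, weighted_sum F n s <= f s <= weighted_sum F n s + 4^-1 ^+ n) ->
  martingale R f.
Proof.
move=> mF Ff s; split.
  (* For [n = 0] the sum is empty and the bounds are 0 and 1. *)
  by have := Ff 0%N s; rewrite /weighted_sum !big_ord0 expr0 add0r.
have PE n : weighted_sum F n s =
    (weighted_sum F n (rcons s false) + weighted_sum F n (rcons s true)) / 2.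
  elim: n => [|n IH]; first by rewrite /weighted_sum !big_ord0 addr0 mul0r.
  by rewrite !weighted_sumS IH (mF n s).2; field.
apply/eqP; rewrite -subr_eq0 -normr_le0 leNgt; apply/negP.
move=> /quarter_expr_lt[n]; apply/negP; rewrite -leNgt ler_norml.
have := Ff n s; have := Ff n (rcons s false); have := Ff n (rcons s true).
rewrite PE; lra.
Qed.

Lemma cvgn_cauchy {R : realType} {u : nat -> R} {e : R} : cvgn u -> 0 < e ->
  exists N, forall p q, (N <= p)%N -> (N <= q)%N -> `|u p - u q| <= e.
Proof.
move=> /cvg_ex[v /cvgrPdist_le uv] e0.
have [|N _ HN] := uv (e / 2); first lra.
exists N => p q Np Nq; have := HN p Np; have := HN q Nq.
rewrite /= !ler_norml; lra.
Qed.

Section weighted_sequence.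
Context {R : realType} (x : nat -> nat -> R) (u : nat -> R)
  (xu : forall n l,
    weighted_sum x n l <= u l <= weighted_sum x n l + 4^-1 ^+ n).

Lemma cvgn_weighted_sum n : (forall k, (k < n)%N -> cvgn (x k)) ->
  cvgn (weighted_sum x n).
Proof.
elim: n => [|n IH] cx.
  rewrite (_ : weighted_sum x 0 = cst 0); first exact: is_cvg_cst.
  by apply/funext => l; rewrite /weighted_sum big_ord0.
rewrite (_ : weighted_sum x n.+1 =
  weighted_sum x n \+ (fun l => 3 / 4 * 4^-1 ^+ n * x n l)); last first.
  by apply/funext => l; rewrite weighted_sumS.
apply: is_cvgD; first by apply: IH => k kn; apply/cx/ltnW.
by apply: is_cvgMr; exact: cx.
Qed.

(** The terms beyond a convergent partial sum move [u] by at most [4^-1 ^+ n]; [e] is shared equally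
    between the two. *)
Lemma not_oscillates_weighted : (forall k, cvgn (x k)) -> ~ oscillates u.
Proof.
move=> cx [e e0 osc_u].
have [|n ne] := @quarter_expr_lt _ (e / 2); first lra.
have [|N HN] := @cvgn_cauchy _ _ (e / 2)
  (cvgn_weighted_sum n (fun k _ => cx k)).
  lra.
have [p [q [Np Nq]]] := osc_u N; apply/negP; rewrite -leNgt.
have := HN p q Np Nq; have := xu n p; have := xu n q.
rewrite !ler_norml; lra.
Qed.

Lemma oscillates_weighted n : (forall k, (k < n)%N -> cvgn (x k)) ->
  (forall N, exists p q,
    [/\ (N <= p)%N, (N <= q)%N & 2^-1 <= x n p - x n q]) ->
  oscillates u.
Proof.
move=> cx osc_x.
have d0 : (0 : R) < 4^-1 ^+ n by rewrite exprn_gt0// invr_gt0.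
(* With [d = 4^-1 ^+ n], term [n] contributes at least [3/4 * d / 2 = 3 d / 8], later terms cancel
   at most [d / 4] and earlier ones at most [d / 32]. What remains, [3 d / 32], exceeds [d / 16]. *)
exists (4^-1 ^+ n / 16); first lra.
move=> M.
have [|N HN] := @cvgn_cauchy _ _ (4^-1 ^+ n / 32) (cvgn_weighted_sum n cx).
  lra.
have [p [q [Np Nq pq]]] := osc_x (maxn M N).
move: Np Nq; rewrite !geq_max => /andP[Mp Np] /andP[Mq Nq].
exists p, q; split => //; apply: lt_le_trans (ler_norm _).
have := HN p q Np Nq; have := xu n.+1 p; have := xu n.+1 q.
rewrite !weighted_sumS exprS ler_norml; move: (4^-1 ^+ n) d0 => d d0.
by move: (weighted_sum x n p) (weighted_sum x n q) => a b ? ? ?; nra.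
Qed.

End weighted_sequence.

(** * Coding Sigma03 subsets of a null set by martingales *)

Lemma martingale_null_Sigma03 {R : realType} (G : set cantor_space)
    (O : nat -> nat -> set cantor_space) :
  coin_measure R G = 0%E -> (forall n k, open (O n k)) ->
  exists2 f : seq bool -> R, martingale R f &
    forall b, G b ->
      oscillates (fun l => f (initseg b l)) <-> (\bigcup_n \bigcap_k O n k) b.
Proof.
move=> G0 oO.
have /choice[F HF] n := martingale_null_Gdelta G (O n) G0 (oO n).
have mF n : martingale R (F n) by have [] := HF n.
have [f Ff] := weighted_sum_lim F (fun n s => (mF n s).1).
exists f; first exact: martingale_weighted_sum_lim mF Ff.
move=> b Gb.
have xu n l : weighted_sum (fun k l => F k (initseg b l)) n l <=
    f (initseg b l) <=
    weighted_sum (fun k l => F k (initseg b l)) n l + 4^-1 ^+ n.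
  exact: Ff.
have cF n : ~ (forall k, O n k b) -> cvgn (fun l => F n (initseg b l)).
  by have [_ _] := HF n; apply.
split=> [osc_f|[m _ Om]].
  apply: contrapT => nb; apply: (not_oscillates_weighted _ _ xu) osc_f => n.
  by apply: cF => On; apply: nb; exists n => // k _; exact: On.
(* For the least such [n] all earlier martingales converge along [b]; the later ones are dominated
   whether they converge or not. *)
have exn : exists n, `[< forall k, O n k b >].
  by exists m; apply/asboolP => k; exact: Om.
case: (ex_minnP exn) => n /asboolP On nmin.
apply: (oscillates_weighted _ _ xu n) => [k kn|].
  by apply: cF => /asboolP/nmin; rewrite leqNgt kn.
by have [_ + _] := HF n; apply.
Qed.

Theorem corollary1p5 (R : realType) (G : set cantor_space)
    (hG : Gdelta G) (hG0 : coin_measure R G = 0%E) :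
  universal_for Sigma03
    ([set p | divergence_set (set_val p.1) (set_val p.2)] :
       set (martingale R * G)%type).
Proof.
have f01 (f : martingale R) s : 0 <= (set_val f : seq bool -> R) s <= 1.
  by have /set_mem/(_ s)[] := valP f.
have UE : [set p : (martingale R * G)%type |
      divergence_set (set_val p.1) (set_val p.2)] =
    [set p | oscillates (fun l => set_val p.1 (initseg (set_val p.2) l))].
  by apply/seteqP; split => p /=; rewrite /divergence_set/= osc_gt0P.
rewrite /universal_for UE; split.
  exact: (Sigma0_oscillates _ _ (fun l (p : (martingale R * G)%type) =>
    set_val p.1 (initseg (set_val p.2) l)) (continuous_value _ _)).
apply/seteqP; split => [A /Sigma03_subtype[U oU AE]|_ [f _ <-]].
  have [f mf fO] := martingale_null_Sigma03 G U hG0 oU.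
  exists (SigSub (mem_set mf) : martingale R) => //.
  rewrite AE; apply/seteqP; split => b /=.
    by move=> /xsectionP/=; rewrite -fO//; exact/set_mem/valP.
  by move=> Ub; apply/xsectionP => /=; rewrite fO//; exact/set_mem/valP.
(* A section is the same oscillation set on [G] with [f] fixed, so the Sigma03 count applies to it
   directly. *)
rewrite (_ : xsection _ f =
  [set b : G | oscillates (fun l => set_val f (initseg (set_val b) l))]).
  apply: (Sigma0_oscillates _ _ (fun l (b : G) =>
    set_val f (initseg (set_val b) l))) => l b.
  apply: (@continuous_comp _ _ _ (fun b : G => (f, b)) _ b _
    (@continuous_value _ _ l (f, b))).
  move=> P [[A B] [/= Af Bb] ABP]; apply: filterS Bb => c Bc.
  by apply: ABP; split => //=; exact: nbhs_singleton.
by apply/seteqP; split => b /=; [move=> /xsectionP|move=> ?; apply/xsectionP].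
Qed.
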